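(* Let $G$ be a countably infinite group generated by finitely many elements $x_1,\dots,x_k$, let $S=\{x_1,\dots,x_k,x_1^{-1},\dots,x_k^{-1}\}$, and let $\mu$ be an arbitrary symmetric probability measure on $G$ concentrated on $S$. Let $v$ be the logarithmic volume of $G$ with respect to $S$, let $h=h(G,\mu)$ be the entropy of the pair $(G,\mu)$, and let $l=l(\mu)$ be the drift (escape) of $\mu$ with respect to the word length $l_S$. Then $$h \le l\cdot v .$$
   Context: Conventions: logarithms are binary. The system of generators is not assumed to be minimal. A measure $\mu$ on $G$ is symmetric if $\mu(g)=\mu(g^{-1})$ for all $g$. ''Concentrated on $S$'' means $\mu(G\setminus S)=0$. Length: for $g\in G$, $l_S(g)$ is the minimal length of a word in the alphabet $S$ representing $g$. $W_n=\{g\in G: l_S(g)=n\}$ and $W_{\le n}=\{g\in G: l_S(g)\le n\}$. Logarithmic volume: $v=\lim_{n\to\infty}\frac{1}{n}\log|W_n|$ (the limit exists because $|W_{n+m}|\le|W_n|\cdot|W_m|$). Convolution powers: $\mu^{*n}(g)=\sum_{g=g_1g_2\cdots g_n}\prod_{i=1}^n\mu(g_i)$; this is a probability measure concentrated on $W_{\le n}$. Entropy: for a probability measure $\nu$ with finite support, $H(\nu)=-\sum_{x}\nu(x)\log\nu(x)$. The entropy of the pair $(G,\mu)$ is $h(G,\mu)=\lim_{n\to\infty}\frac1n H(\mu^{*n})$ (the limit exists because $H(\nu_1*\nu_2)\le H(\nu_1)+H(\nu_2)$). Drift (escape): $l(\mu)=\lim_{n\to\infty}\frac1n\sum_{g\in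 G}l_S(g)\,\mu^{*n}(g)$, i.e. the limit of the normalized mean word length after $n$ steps of the random walk with step distribution $\mu$ (the limit exists by subadditivity). *)

(* Defs.v *)
From HB Require Import structures.
From mathcomp Require Import all_boot all_order all_algebra finmap.
From mathcomp Require Import all_classical all_reals all_analysis.

Set Implicit Arguments.
Unset Strict Implicit.
Unset Printing Implicit Defensive.

Import Order.TTheory GRing.Theory Num.Theory.
Import numFieldNormedType.Exports.

Local Open Scope classical_set_scope.
Local Open Scope ring_scope.

Definition log2 {R : realType} (x : R) : R := ln x / ln 2.

Section WordMetric.
Variable G : groupType.

Definition sym_gens (k : nat) (x : 'I_k -> G) : set G :=
  range x `|` [set (x i)^-1%g | i in [set: 'I_k]].

Definition word_repr (S : set G) (n : nat) (g : G) : Prop :=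
  exists w : n.-tuple G,
    (forall i, S (tnth w i)) /\ (\prod_(i < n) tnth w i)%g = g.

Definition generated_by (k : nat) (x : 'I_k -> G) : Prop :=
  forall g : G, exists n : nat, word_repr (sym_gens x) n g.

(* The value 0 for elements that are not represented by any word is
   irrelevant when S generates G. *)
Definition word_length (S : set G) (g : G) : nat :=
  match pselect (exists n, `[< word_repr S n g >]) with
  | left ex => ex_minn ex
  | right _ => 0%N
  end.

Definition sphere (S : set G) (n : nat) : set G :=
  [set g | word_length S g = n].

End WordMetric.

Section RandomWalk.
Variables (R : realType) (G : groupType).

(* A measure on the countable group G is given by its point masses mu g;
   [mass mu A] is then the measure of A. *)
Definition mass (mu : G -> R) (A : set G) : \bar R :=
  \esum_(g in A) (mu g)%:E.

Definition is_probability (mu : G -> R) : Prop :=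
  (forall g, 0 <= mu g) /\ mass mu [set: G] = 1%E.

Definition concentrated_on (mu : G -> R) (S : set G) : Prop :=
  mass mu (~` S) = 0%E.

Definition symmetric_measure (mu : G -> R) : Prop :=
  forall g, mu g = mu g^-1%g.

(* The sums \sum_(_ \in _) below range over the finite support of the summand:
   they are the intended sums for a measure mu concentrated on a finite set. *)
Definition conv_pow (mu : G -> R) (n : nat) (g : G) : R :=
  \sum_(w \in [set w : n.-tuple G | (\prod_(i < n) tnth w i)%g = g])
    \prod_(i < n) mu (tnth w i).

(* 0 * log 0 = 0, as usual for the entropy. *)
Definition shannon (nu : G -> R) : R :=
  - \sum_(g \in [set: G]) (nu g * log2 (nu g)).

Definition log_volume (S : set G) : R :=
  limn (fun n : nat => n%:R^-1 * log2 (#|` fset_set (sphere S n)|%:R : R)).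

Definition entropy (mu : G -> R) : R :=
  limn (fun n : nat => n%:R^-1 * shannon (conv_pow mu n)).

Definition drift (S : set G) (mu : G -> R) : R :=
  limn (fun n : nat => n%:R^-1 *
    \sum_(g \in [set: G]) ((word_length S g)%:R * conv_pow mu n g)).

End RandomWalk.

Arguments log_volume R {G} S.

(* Main.v *)
(* Write [L n] for the mean word length at time [n] and [a j] for the logarithm
   of the cardinal of the sphere of radius [j]. Gibbs' inequality, comparing
   [mu^{*n}] with the law that is uniform in the length [j <= n] and then
   uniform on the sphere of radius [j], gives
     H(mu^{*n}) <= log (n + 1) + E[a (l_S (X_n))].
   Since [a] is subadditive, [a j <= j * (a m / m) + C_m] for every [m > 0],
   hence H(mu^{*n}) <= log (n + 1) + L n * (a m / m) + C_m. Dividing by [n] and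
   letting [n] tend to infinity yields [h <= l * (a m / m)] for every [m > 0];
   then let [m] tend to infinity. The three limits exist by Fekete's lemma. *)

Require Import Defs.
From mathcomp Require Import zify lra.
From HB Require Import structures.
From mathcomp Require Import all_boot all_order all_algebra finmap.
From mathcomp Require Import all_classical all_reals all_analysis.

Set Implicit Arguments.
Unset Strict Implicit.
Unset Printing Implicit Defensive.

Import Order.TTheory GRing.Theory Num.Theory.
Import numFieldNormedType.Exports.

Local Open Scope classical_set_scope.
Local Open Scope ring_scope.

Lemma ln2_gt0 (R : realType) : 0 < ln 2 :> R.
Proof. by rewrite ln_gt0// ltr1n. Qed.

Lemma cvg_natV0 (R : realType) : (n%:R^-1 : R) @[n --> \oo] --> 0.
Proof. by rewrite -cvg_shiftS; exact: cvg_harmonic. Qed.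

(** * Nonnegative subadditive sequences and Fekete's lemma *)

Section Subadditive.
Variables (R : realType) (u : nat -> R).
Hypothesis u_ge0 : forall n, 0 <= u n.
Hypothesis u_sub : forall m n, u (m + n)%N <= u m + u n.

Lemma subadditive_mul_le (q m r : nat) : u (q * m + r)%N <= q%:R * u m + u r.
Proof.
elim: q => [|q IH]; first by rewrite mul0r add0r.
by rewrite mulSn -addnA (le_trans (u_sub _ _))// -natr1 mulrDl mul1r addrAC
  [leRHS]addrC lerD2l.
Qed.

(** Write [n = q * m + r] with [r < m]: the [q] blocks cost at most [q * u m], with [q <= n / m],
    and [u r] is one term of the sum. The error term is independent of [n]. *)
Lemma subadditive_linear_bound (m n : nat) : (0 < m)%N ->
  u n <= n%:R * (m%:R^-1 * u m) + \sum_(i < m) u i.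
Proof.
move=> m_gt0; rewrite {1}(divn_eq n m).
apply: le_trans (subadditive_mul_le _ _ _) _; apply: lerD.
  rewrite mulrA ler_wpM2r//.
  by rewrite ler_pdivlMr ?ltr0n// -natrM ler_nat leq_divM.
rewrite (bigD1 (Ordinal (ltn_pmod n m_gt0)))//= lerDl.
by apply: sumr_ge0.
Qed.

(** The limit is the infimum of [u n / n]. For [m] nearly attaining it, the linear bound gives
    [u n / n <= u m / m + C / n], and [C / n] vanishes. *)
Lemma fekete : cvgn (fun n => n%:R^-1 * u n).
Proof.
(* The index 0 is excluded: since [0^-1 = 0], it would put 0 into [A] and force the infimum to be
   0. *)
pose A := [set n%:R^-1 * u n | n in [set n | (0 < n)%N]].
have A0 : lbound A 0 by move=> _ [n _ <-]; rewrite mulr_ge0 ?invr_ge0.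
have hA : has_inf A by split; [exists (1%:R^-1 * u 1%N), 1%N | exists 0].
apply/cvg_ex; exists (inf A); apply/cvgrPdist_le => e e0.
have e20 : 0 < e / 2 by rewrite divr_gt0.
have [_ [m /= m0 <-] Hm] := inf_adherent e20 hA.
pose C := \sum_(i < m) u i.
have : (n%:R^-1 * C : R) @[n --> \oo] --> 0 * C.
  by apply: cvgMr_tmp; exact: cvg_natV0.
rewrite mul0r => /cvgrPdist_le /(_ _ e20) HC.
near=> n.
have n0 : (0 < n)%N by near: n; exact: nbhs_infty_gt.
have lb : inf A <= n%:R^-1 * u n by apply: ge_inf; [exists 0|exists n].
rewrite distrC ger0_norm ?subr_ge0// lerBlDl.
have HCn : n%:R^-1 * C <= e / 2.
  have : `|0 - n%:R^-1 * C| <= e / 2 by near: n.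
  by rewrite sub0r normrN; apply: le_trans; exact: ler_norm.
have := subadditive_linear_bound n m0.
rewrite -(ler_pM2l (_ : 0 < n%:R^-1 :> R)) ?invr_gt0 ?ltr0n// mulrDr mulKf ?pnatr_eq0 -?lt0n//.
move/le_trans; apply; rewrite (splitr e) addrA.
by rewrite lerD// ltW.
Unshelve. all: by end_near.
Qed.

End Subadditive.

(** Squeeze: [ln y <= 2 * sqrt y] and [n + 1 <= 4 * n] bound the quotient by [4 / sqrt n]. *)
Lemma cvg_ln_div (R : realType) : (n%:R^-1 * ln n.+1%:R : R) @[n --> \oo] --> 0.
Proof.
have ln_sqrt (y : R) : 1 <= y -> ln y <= 2 * Num.sqrt y.
  move=> y1; have y0 : 0 < y by rewrite (lt_le_trans ltr01).
  rewrite -{1}(sqr_sqrtr (ltW y0)) lnXn ?sqrtr_gt0// mulr_natl lerMn2r/=.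
  by apply: ltW; apply: ln_sublinear; rewrite sqrtr_gt0.
pose g n : R := 4 * Num.sqrt (n%:R^-1).
have gcvg : g n @[n --> \oo] --> 0.
  have -> : 0 = 4 * Num.sqrt (0 : R) by rewrite sqrtr0 mulr0.
  apply: cvgMl_tmp; apply: continuous_cvg; first exact: sqrt_continuous.
  exact: cvg_natV0.
apply: (squeeze_cvgr (f := fun=> 0)) gcvg; last exact: cvg_cst.
near=> n.
have n0 : (0 < n)%N by near: n; exact: nbhs_infty_gt.
rewrite mulr_ge0 ?invr_ge0 ?ln_ge0 ?ler1n//=.
have nR : 0 < n%:R :> R by rewrite ltr0n.
rewrite /g.
have sp : 0 < Num.sqrt (n%:R : R) by rewrite sqrtr_gt0.
rewrite sqrtrV ?ler0n// ler_pdivrMl//.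
apply: le_trans (ln_sqrt _ _) _; first by rewrite ler1n.
have -> : n%:R * (4 * (Num.sqrt n%:R)^-1) = 2 * (2 * Num.sqrt n%:R) :> R.
  rewrite -[X in X * _](sqr_sqrtr (ltW nR)) expr2 mulrCA !mulrA mulfK ?gt_eqF//.
  by rewrite -!natrM.
rewrite ler_pM2l//.
have -> : 2 = Num.sqrt (4 : R).
  by rewrite (_ : 4 = 2 ^+ 2) ?sqrtr_sqr ?ger0_norm// expr2 -natrM.
rewrite -sqrtrM ?ler0n// ler_wsqrtr// -natrM ler_nat.
by rewrite -[X in (X <= _)%N]addn1 (leq_trans (leq_add (leqnn n) n0))// addnn -mul2n leq_mul2r orbT.
Unshelve. all: by end_near.
Qed.

(** * Words, word length and submultiplicativity of spheres *)

Section WordLength.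
Variables (G : groupType) (S : set G).

Lemma word_repr_seq (n : nat) (g : G) : word_repr S n g <->
  exists s : seq G, [/\ size s = n, {in s, forall y, S y} & (\prod_(y <- s) y)%g = g].
Proof.
split=> [[w [Sw <-]]|[s [sn Ss <-]]].
  exists w; split; rewrite ?size_tuple// ?big_tuple//.
  by move=> y /tnthP[i ->].
have sP : size s == n by rewrite sn.
exists (Tuple sP); split=> [i|]; first exact/Ss/mem_tnth.
by rewrite -[RHS]/(\prod_(y <- Tuple sP) y)%g big_tuple.
Qed.

Lemma word_repr0 (g : G) : word_repr S 0 g <-> g = 1%g.
Proof.
rewrite word_repr_seq; split=> [[s [/size0nil-> _ <-]]|->]; first by rewrite big_nil.
by exists [::]; rewrite big_nil; split.
Qed.

Lemma word_repr1 (g : G) : S g -> word_repr S 1 g.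
Proof.
move=> Sg; apply/word_repr_seq; exists [:: g]; rewrite big_seq1; split=> //.
by move=> y; rewrite inE => /eqP->.
Qed.

Lemma word_reprM (m n : nat) (g h : G) :
  word_repr S m g -> word_repr S n h -> word_repr S (m + n) (g * h)%g.
Proof.
rewrite !word_repr_seq => -[s [<- Ss <-]] [t [<- St <-]].
exists (s ++ t); rewrite size_cat big_cat; split=> // y.
by rewrite mem_cat => /orP[/Ss|/St].
Qed.

Lemma word_repr_split (m n : nat) (g : G) : word_repr S (m + n) g ->
  exists a b, [/\ word_repr S m a, word_repr S n b & g = (a * b)%g].
Proof.
rewrite word_repr_seq => -[s [sn Ss <-]].
exists (\prod_(y <- take m s) y)%g, (\prod_(y <- drop m s) y)%g.
rewrite -big_cat cat_take_drop; split=> //; apply/word_repr_seq.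
- exists (take m s); split=> //; last by move=> y /mem_take/Ss.
  by rewrite size_takel// sn leq_addr.
- exists (drop m s); split=> //; last by move=> y /mem_drop/Ss.
  by rewrite size_drop sn addKn.
Qed.

Lemma word_length_le (n : nat) (g : G) :
  word_repr S n g -> (word_length S g <= n)%N.
Proof.
rewrite /word_length => Sng; case: pselect => // ex.
by case: ex_minnP => i _; apply; exact/asboolP.
Qed.

Lemma finite_word_repr (n : nat) : finite_set S ->
  finite_set [set g | word_repr S n g].
Proof.
move=> Sfin; elim: n => [|n IH].
  by apply: sub_finite_set (finite_set1 1%g) => g /word_repr0.
apply: sub_finite_set (finite_image2 (fun a b => (a * b)%g) Sfin IH).
move=> g; rewrite -add1n => /word_repr_split[a [b [+ Sb ->]]].
rewrite word_repr_seq => -[[|a' [|? ?]] [//= _ Sa <-]].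
by rewrite big_seq1; exists a'; [apply: Sa; rewrite inE|exists b].
Qed.

Hypothesis S_gen : forall g, exists n, word_repr S n g.

Lemma word_lengthP (g : G) : word_repr S (word_length S g) g.
Proof.
rewrite /word_length; case: pselect => [ex|[]].
  by case: ex_minnP => i /asboolP.
by have [n Sng] := S_gen g; exists n; exact/asboolP.
Qed.

Lemma word_lengthM (g h : G) :
  (word_length S (g * h)%g <= word_length S g + word_length S h)%N.
Proof. by apply/word_length_le/word_reprM; exact: word_lengthP. Qed.

(** Cut a shortest word after [m] letters. The two factors have lengths at most [m] and [n], and by
    [word_lengthM] these add up to at least [m + n], so both bounds are equalities. *)
Lemma sphereD (m n : nat) (g : G) : sphere S (m + n) g ->
  exists a b, [/\ sphere S m a, sphere S n b & g = (a * b)%g].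
Proof.
rewrite /sphere/= => gmn; have := word_lengthP g; rewrite gmn.
move=> /word_repr_split[a [b [/word_length_le Sa /word_length_le Sb gE]]].
exists a, b; have := word_lengthM a b; rewrite -gE gmn => lmn.
by split=> //; apply/eqP; rewrite eqn_leq ?Sa ?Sb/=; lia.
Qed.

Lemma finite_sphere (n : nat) : finite_set S -> finite_set (sphere S n).
Proof.
move=> Sfin; apply: sub_finite_set (finite_word_repr n Sfin) => g <-.
exact: word_lengthP.
Qed.

Lemma card_sphereD (m n : nat) : finite_set S ->
  (#|` fset_set (sphere S (m + n))| <=
   #|` fset_set (sphere S m)| * #|` fset_set (sphere S n)|)%N.
Proof.
move=> Sfin.
rewrite -(size_allpairs (fun a b : G => (a * b)%g)); apply: uniq_leq_size => // g.
rewrite in_fset_set ?inE; last exact: finite_sphere.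
move=> /sphereD[a [b [Sa Sb ->]]]; apply: (allpairs_f (fun a b : G => (a * b)%g)).
  by rewrite in_fset_set ?inE//; exact: finite_sphere.
by rewrite in_fset_set ?inE//; exact: finite_sphere.
Qed.

End WordLength.

(** * Expectations along the random walk; subadditivity of entropy and mean length *)

Section RandomWalkExpectation.
Variables (R : realType) (G : groupType) (S : set G) (mu : G -> R).
Hypothesis S_fin : finite_set S.
Hypothesis mu_ge0 : forall g, 0 <= mu g.
Hypothesis mu_out : forall g, ~ S g -> mu g = 0.
Hypothesis mu_sum : \sum_(s \in S) mu s = 1.

(* [walk n phi] is the expectation of [phi] at time [n], i.e. the integral of
   [phi] against [conv_pow mu n] (see [fsum_conv_pow]); the recursion
   conditions on the first step. *)
Fixpoint walk (n : nat) (phi : G -> R) : R :=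
  if n is n'.+1 then \sum_(s \in S) mu s * walk n' (fun g => phi (s * g)%g)
  else phi 1%g.

Lemma le_walk (n : nat) (phi psi : G -> R) :
  (forall g, word_repr S n g -> phi g <= psi g) -> walk n phi <= walk n psi.
Proof.
elim: n phi psi => [|n IH] phi psi le_phi /=; first exact/le_phi/word_repr0.
rewrite !fsbig_finite//=; rewrite big_seq [leRHS]big_seq; apply: ler_sum => s.
rewrite in_fset_set ?inE// => Ss; rewrite ler_wpM2l//.
apply: IH => g Sg; apply: le_phi; rewrite -add1n; apply: word_reprM => //.
exact: word_repr1.
Qed.

Lemma eq_walk (n : nat) (phi psi : G -> R) :
  (forall g, word_repr S n g -> phi g = psi g) -> walk n phi = walk n psi.
Proof.
move=> eq_phi; apply/eqP; rewrite eq_le.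
by rewrite !le_walk// => g /eq_phi ->.
Qed.

(** Independence of the first [m] and the last [n] increments. Both subadditivity statements rest on
    it. *)
Lemma walkD (m n : nat) (phi : G -> R) :
  walk (m + n) phi = walk m (fun a => walk n (fun b => phi (a * b)%g)).
Proof.
elim: m phi => [|m IH] phi /=.
  by apply: eq_walk => g _; rewrite mul1g.
apply: eq_fsbigr => s _; rewrite IH; congr (_ * _).
by apply: eq_walk => a _; apply: eq_walk => b _; rewrite mulgA.
Qed.

Lemma walk_add (n : nat) (phi psi : G -> R) :
  walk n (fun g => phi g + psi g) = walk n phi + walk n psi.
Proof.
elim: n phi psi => [//|n IH] phi psi /=.
rewrite -fsbig_split//=; apply: eq_fsbigr => s _.
by rewrite IH mulrDr.
Qed.

Lemma walkZ (n : nat) (c : R) (phi : G -> R) :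
  walk n (fun g => c * phi g) = c * walk n phi.
Proof.
elim: n phi => [//|n IH] phi /=.
rewrite mulr_fsumr; apply: eq_fsbigr => s _.
by rewrite IH mulrCA.
Qed.

Lemma walk_cst (n : nat) (c : R) : walk n (fun=> c) = c.
Proof.
elim: n => [//|n IH] /=.
by rewrite -mulr_fsuml mu_sum mul1r.
Qed.

Lemma walk_sum (I : Type) (r : seq I) (n : nat) (phi : I -> G -> R) :
  walk n (fun g => \sum_(i <- r) phi i g) = \sum_(i <- r) walk n (phi i).
Proof.
elim: r => [|i r IH].
  rewrite big_nil -[RHS](walk_cst n); apply: eq_walk => g _.
  by rewrite big_nil.
rewrite big_cons -IH -walk_add; apply: eq_walk => g _.
by rewrite big_cons.
Qed.

Definition words (n : nat) : set (n.-tuple G) :=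
  [set w | forall i, S (tnth w i)].
Arguments words : clear implicits.

Lemma set_bij_cons_words (n : nat) :
  set_bij (S `*` words n) (words n.+1)
    (fun p : G * n.-tuple G => [tuple of p.1 :: p.2]).
Proof.
split.
- move=> [s w] [/= Ss Sw] i.
  by have [j ->|->] := unliftP ord0 i; rewrite ?tnthS ?tnth0.
- by move=> [s w] [s' w'] _ _ /(congr1 val)[-> /val_inj ->].
- move=> w Sw; exists (thead w, [tuple of behead w]); last by rewrite /= -tuple_eta.
  split=> /=; first exact: Sw.
  by move=> i; rewrite tnth_behead; exact: Sw.
Qed.

Lemma finite_words (n : nat) : finite_set (words n).
Proof.
elim: n => [|n IH].
  by apply: sub_finite_set (finite_set1 [tuple]) => w _; exact: tuple0.
have [_ _ surj] := set_bij_cons_words n.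
by apply: sub_finite_set surj _; apply: finite_image; exact: finite_setX.
Qed.

(** Unrolls the recursion into a sum over words, the form used by [conv_pow]; the bijection above
    splits off the first letter. *)
Lemma walk_words (n : nat) (phi : G -> R) : walk n phi =
  \sum_(w \in words n) phi (\prod_(i < n) tnth w i)%g *
    \prod_(i < n) mu (tnth w i).
Proof.
elim: n phi => [|n IH] phi /=.
  rewrite (_ : words 0 = [set [tuple]]).
    by rewrite fsbig_set1 !big_ord0 mulr1.
  by apply/seteqP; split=> w _ /=; [exact: tuple0|case].
rewrite (reindex_fsbig _ _ _ _ (set_bij_cons_words n)).
rewrite [RHS](_ : _ = \sum_(s \in S) \sum_(w \in words n)
    phi (\prod_(i < n.+1) tnth [tuple of s :: w] i)%g *
    \prod_(i < n.+1) mu (tnth [tuple of s :: w] i)); last first.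
  by rewrite pair_fsbig//; exact: finite_words.
apply: eq_fsbigr => s _; rewrite IH mulr_fsumr; apply: eq_fsbigr => w _.
rewrite !big_ord_recl !tnth0 mulrCA.
by congr (phi (_ * _)%g * (_ * _)); apply: eq_bigr => i _; rewrite tnthS.
Qed.

Lemma conv_powE (n : nat) (g : G) :
  conv_pow mu n g = walk n (fun h => (h == g)%:R).
Proof.
rewrite walk_words /conv_pow.
set A := [set w | _].
(* A word with a letter outside [S] has weight 0, so the sum over all tuples reduces to the finite
   set of words over [S]. *)
rewrite -(fsbig_widen (A `&` words n) A)/=; last 2 first.
- exact: subIsetl.
- move=> w [/= _ /not_andP[//|]] /existsNP[i /mu_out mui].
  by rewrite (bigD1 i)//= mui mul0r.
rewrite fsbig_mkcondl; apply: eq_fsbigr => w _.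
by case: ifPn => [|/negP]; rewrite inE/=; [move=> ->|move=> /eqP/negPf->];
  rewrite ?eqxx ?mul1r ?mul0r.
Qed.

Lemma conv_pow_ge0 (n : nat) (g : G) : 0 <= conv_pow mu n g.
Proof.
by rewrite conv_powE -[leLHS](walk_cst n); apply: le_walk.
Qed.

Lemma conv_pow_le1 (n : nat) (g : G) : conv_pow mu n g <= 1.
Proof.
rewrite conv_powE -[leRHS](walk_cst n); apply: le_walk => h _.
by case: eqP.
Qed.

Lemma conv_pow_gt0_word (n : nat) (g : G) :
  0 < conv_pow mu n g -> word_repr S n g.
Proof.
apply: contraPP => Sg; apply/negP; rewrite -leNgt conv_powE.
rewrite -[leRHS](walk_cst n); apply: le_walk => h Sh.
by case: eqP Sh => // ->.
Qed.

(** Decompose [phi] into indicators of single points; [conv_pow mu n g] is the expectation of the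
    indicator of [g]. *)
Lemma walkE (n : nat) (phi : G -> R) : walk n phi =
  \sum_(g <- fset_set [set g | word_repr S n g]) phi g * conv_pow mu n g.
Proof.
under eq_bigr do rewrite conv_powE -walkZ.
rewrite -walk_sum; apply: eq_walk => g Sg.
rewrite (bigD1_seq g) ?fset_uniq//=; last first.
  by rewrite in_fset_set ?inE//; exact: finite_word_repr.
rewrite eqxx mulr1 big1 ?addr0// => h.
by rewrite eq_sym => /negPf->; rewrite mulr0.
Qed.

Lemma fsum_conv_pow (n : nat) (phi : G -> R) :
  \sum_(g \in [set: G]) phi g * conv_pow mu n g = walk n phi.
Proof.
rewrite walkE; apply: fsbigTE => g.
rewrite in_fset_set ?inE/=; last exact: finite_word_repr.
move=> /negP; rewrite inE => Sg; suff -> : conv_pow mu n g = 0 by rewrite mulr0.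
apply/eqP; rewrite eq_le conv_pow_ge0 andbT leNgt.
by apply/negP => /conv_pow_gt0_word.
Qed.

(** Meant for logarithms of point masses: where the mass is 0, the default [ln 0 = 0] makes
    pointwise comparison meaningless. *)
Lemma le_walk_supp (n : nat) (phi psi : G -> R) :
  (forall g, 0 < conv_pow mu n g -> phi g <= psi g) -> walk n phi <= walk n psi.
Proof.
move=> le_phi; rewrite !walkE; apply: ler_sum => g _.
have := conv_pow_ge0 n g; rewrite le_eqVlt => /orP[/eqP<-|g0].
  by rewrite !mulr0.
by rewrite ler_pM2r// le_phi.
Qed.

(** Reaching [a] in [m] steps and then moving by [b] in [n] steps is one of the ways to reach
    [a * b]. *)
Lemma conv_powM_le (m n : nat) (a b : G) :
  conv_pow mu m a * conv_pow mu n b <= conv_pow mu (m + n) (a * b)%g.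
Proof.
rewrite mulrC [X in _ * X]conv_powE -walkZ [leRHS]conv_powE walkD.
apply: le_walk => a' _; case: eqP => [->|_]; last first.
  by rewrite mulr0 -[leLHS](walk_cst n); apply: le_walk.
rewrite mulr1 conv_powE; apply: le_walk => b' _.
by case: eqP => [->|_]; rewrite ?eqxx.
Qed.

Lemma shannonE (n : nat) :
  shannon (conv_pow mu n) = walk n (fun g => - log2 (conv_pow mu n g)).
Proof.
rewrite /shannon -fsum_conv_pow -mulN1r mulr_fsumr.
by apply: eq_fsbigr => g _; rewrite mulN1r mulrC mulNr.
Qed.

Lemma shannon_ge0 (n : nat) : 0 <= shannon (conv_pow mu n).
Proof.
rewrite shannonE -[leLHS](walk_cst n); apply: le_walk => g _.
rewrite oppr_ge0 /log2 pmulr_lle0 ?invr_gt0 ?ln2_gt0// ln_le0//.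
exact: conv_pow_le1.
Qed.

(** Take [- log2] in [conv_powM_le] and average over independent [a] and [b]; no conditional entropy
    is involved. *)
Lemma shannon_subadd (m n : nat) : shannon (conv_pow mu (m + n)) <=
  shannon (conv_pow mu m) + shannon (conv_pow mu n).
Proof.
rewrite !shannonE walkD -[X in _ + X](walk_cst m) -walk_add.
apply: le_walk_supp => a a0; rewrite -[X in X + _](walk_cst n) -walk_add.
apply: le_walk_supp => b b0.
rewrite -opprD lerN2 /log2 -mulrDl ler_pM2r ?invr_gt0 ?ln2_gt0//.
have ab0 : 0 < conv_pow mu m a * conv_pow mu n b by rewrite mulr_gt0.
rewrite -lnM ?posrE// ler_ln ?posrE// ?(lt_le_trans ab0)//; exact: conv_powM_le.
Qed.

Hypothesis S_gen : forall g, exists n, word_repr S n g.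

Definition mean_length (n : nat) : R := walk n (fun g => (word_length S g)%:R).

Lemma mean_length_subadd (m n : nat) :
  mean_length (m + n) <= mean_length m + mean_length n.
Proof.
rewrite /mean_length walkD -[X in _ + X](walk_cst m) -walk_add.
apply: le_walk => a _; rewrite -[X in X + _](walk_cst n) -walk_add.
apply: le_walk => b _; rewrite -natrD ler_nat; exact: word_lengthM.
Qed.

Lemma mean_length_ge0 (n : nat) : 0 <= mean_length n.
Proof. by rewrite -[leLHS](walk_cst n); apply: le_walk. Qed.

End RandomWalkExpectation.

(** * Gibbs' inequality against the sphere law and passage to the limits *)

Section EntropyBound.
Variables (R : realType) (G : groupType) (S : set G) (mu : G -> R).
Hypothesis S_fin : finite_set S.
Hypothesis S_gen : forall g, exists n, word_repr S n g.
Hypothesis mu_ge0 : forall g, 0 <= mu g.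
Hypothesis mu_out : forall g, ~ S g -> mu g = 0.
Hypothesis mu_sum : \sum_(s \in S) mu s = 1.

Local Notation sphere_card n := (#|` fset_set (sphere S n)|%:R : R).
(** Elements given by words of exactly [n] letters: this lies in the metric ball, possibly strictly,
    and contains the support of [conv_pow mu n]. *)
Local Notation ball n := (fset_set [set g | word_repr S n g]).

(* Valid for an empty sphere as well, since [ln 0 = 0]. *)
Lemma log_sphere_ge0 (n : nat) : 0 <= log2 (sphere_card n).
Proof.
rewrite /log2 divr_ge0 ?(ltW (ln2_gt0 R))//.
case: #|` _| => [|c]; first by rewrite ln0.
by rewrite ln_ge0// ler1n.
Qed.

Lemma log_sphere_subadd (m n : nat) : log2 (sphere_card (m + n)) <=
  log2 (sphere_card m) + log2 (sphere_card n).
Proof.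
have := card_sphereD S_gen m n S_fin.
case: (posnP #|` fset_set (sphere S (m + n))|) => [-> _|mn0 le_mn].
  by rewrite {1}/log2 ln0// mul0r addr_ge0// log_sphere_ge0.
have : (0 < #|` fset_set (sphere S m)| * #|` fset_set (sphere S n)|)%N.
  exact: leq_trans le_mn.
rewrite muln_gt0 => /andP[m0 n0].
rewrite /log2 -mulrDl ler_pM2r ?invr_gt0 ?ln2_gt0// -lnM ?posrE ?ltr0n//.
by rewrite -natrM ler_ln ?posrE ?ltr0n ?muln_gt0 ?m0// ler_nat.
Qed.

Lemma sphere_card_gt0 (g : G) : 0 < sphere_card (word_length S g).
Proof.
rewrite ltr0n cardfs_gt0; apply/fset0Pn; exists g.
by rewrite in_fset_set ?inE//; exact: finite_sphere.
Qed.

(** Group by length: each of the [n + 1] lengths contributes at most [1 / (n + 1)], with inequality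
    because [ball n] may miss part of a sphere. *)
Lemma sum_uniform_spheres_le1 (n : nat) :
  \sum_(g <- ball n) (n.+1%:R * sphere_card (word_length S g))^-1 <= 1.
Proof.
pose q j : R := (n.+1%:R * sphere_card j)^-1.
have -> : \sum_(g <- ball n) q (word_length S g) =
    \sum_(g <- ball n) \sum_(j < n.+1) q j * (word_length S g == j)%:R.
  apply: eq_big_seq => g; rewrite in_fset_set ?inE; last exact: finite_word_repr.
  move=> /word_length_le; rewrite -ltnS => gn.
  rewrite (bigD1 (Ordinal gn))//= eqxx mulr1 big1 ?addr0// => j.
  by rewrite -val_eqE eq_sym /= => /negPf->; rewrite mulr0.
rewrite exchange_big/=.
rewrite [leRHS](_ : 1 = \sum_(j < n.+1) n.+1%:R^-1 :> R); last first.
  by rewrite sumr_const card_ord -[RHS]mulr_natl mulfV ?pnatr_eq0.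
apply: ler_sum => j _; rewrite -mulr_sumr.
have count_le : \sum_(g <- ball n) (word_length S g == j)%:R <= sphere_card j.
  rewrite -natr_sum ler_nat.
  rewrite (_ : (\sum_(g <- _) _)%N =
      size [seq g <- ball n | word_length S g == j]); last first.
    rewrite size_filter -sum1_count [RHS]big_mkcond.
    by apply: eq_bigr => g _; case: eqP.
  apply: uniq_leq_size; first exact/filter_uniq/fset_uniq.
  move=> g; rewrite mem_filter => /andP[/eqP gj _].
  by rewrite in_fset_set ?inE//; exact: finite_sphere.
rewrite /q invfM -mulrA ler_piMr// ?invr_ge0//.
(* An empty sphere contributes 0, by the convention [0^-1 = 0]. *)
have [->|c0] := eqVneq (sphere_card j) 0; first by rewrite invr0 mul0r.
by rewrite ler_pdivrMl ?mulr1// lt0r c0 ler0n.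
Qed.

(* Gibbs' inequality against the law that is uniform in the length
   [0 <= j <= n] and, given the length, uniform on the sphere. *)
Lemma shannon_le_log_sphere (n : nat) : shannon (conv_pow mu n) <=
  log2 n.+1%:R + walk S mu n (fun g => log2 (sphere_card (word_length S g))).
Proof.
rewrite (shannonE S_fin)//.
pose q g : R := (n.+1%:R * sphere_card (word_length S g))^-1.
pose p := conv_pow mu n.
have l20 := ln2_gt0 R.
(* The pointwise bound is [ln t <= t - 1] at [t = q g / p g], divided by [ln 2]. The correction term
   averages to at most 0, because the [q g] sum to at most 1. *)
suff : walk S mu n (fun g => - log2 (p g)) <=
    walk S mu n (fun g => log2 n.+1%:R + log2 (sphere_card (word_length S g))
      + (ln 2)^-1 * (q g / p g + -1)).
  rewrite !walk_add// (walkZ _ _ _ (ln 2)^-1) walk_add// !walk_cst//.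
  move=> /le_trans; apply; rewrite gerDl pmulr_rle0 ?invr_gt0// subr_le0.
  rewrite walkE//; apply: le_trans (sum_uniform_spheres_le1 n).
  (* [q g / p g * p g] is [q g] where [p g > 0], and 0 elsewhere. *)
  apply: ler_sum => g _; have := conv_pow_ge0 S_fin mu_ge0 mu_out mu_sum n g.
  rewrite le_eqVlt => /orP[/eqP <-|g0]; last by rewrite divfK// gt_eqF.
  by rewrite mulr0 invr_ge0 mulr_ge0// ler0n.
apply: le_walk_supp => // g g0.
have c0 := sphere_card_gt0 g; have n0 : 0 < n.+1%:R :> R by rewrite ltr0n.
have q0 : 0 < q g by rewrite invr_gt0 mulr_gt0.
rewrite /log2 [(ln 2)^-1 * _]mulrC -!mulrDl -mulNr ler_pM2r ?invr_gt0//.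
have : ln (1 + (q g / p g + -1)) <= q g / p g + -1.
  by apply: le_ln1Dx; rewrite ltrDr divr_gt0.
rewrite addrCA subrr addr0 ln_div ?posrE// /q lnV ?posrE ?mulr_gt0// lnM ?posrE//.
rewrite -/(p g) -/(q g); lra.
Qed.

Lemma entropy_le_drift_mul (m : nat) : (0 < m)%N ->
  entropy mu <= drift S mu * (m%:R^-1 * log2 (sphere_card m)).
Proof.
move=> m0; set v := _ * log2 _; pose C := \sum_(j < m) log2 (sphere_card j).
have v0 : 0 <= v by rewrite mulr_ge0 ?invr_ge0// log_sphere_ge0.
have Lcvg : n%:R^-1 * mean_length S mu n @[n --> \oo] --> drift S mu.
  have -> : drift S mu = limn (fun n => n%:R^-1 * mean_length S mu n).
    congr (limn _); apply/funext => n.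
    by rewrite (fsum_conv_pow S_fin mu_ge0 mu_out mu_sum).
  apply: fekete; [exact: mean_length_ge0|exact: mean_length_subadd].
have Hcvg : cvgn (fun n => n%:R^-1 * shannon (conv_pow mu n)).
  apply: (fekete (u := fun n => shannon (conv_pow mu n))).
  - by move=> n; exact: (shannon_ge0 S_fin).
  - by move=> i j; exact: (shannon_subadd S_fin).
have Hle n : shannon (conv_pow mu n) <=
    log2 n.+1%:R + (mean_length S mu n * v + C).
  (* The linear bound for the log-cardinals is applied at the random index [word_length S g] and
     then averaged; being linear in the length, it brings out [mean_length]. *)
  apply: le_trans (shannon_le_log_sphere n) _; rewrite lerD2l mulrC -walkZ//.
  rewrite -[C in leRHS](walk_cst mu_sum n) -walk_add//.
  apply: le_walk => // g _; rewrite mulrC.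
  apply: (subadditive_linear_bound (u := fun j => log2 (sphere_card j))) => //.
  - exact: log_sphere_ge0.
  - exact: log_sphere_subadd.
have Bcvg : (n%:R^-1 * ln n.+1%:R) * (ln 2)^-1 +
    ((n%:R^-1 * mean_length S mu n) * v + n%:R^-1 * C) @[n --> \oo] -->
    0 * (ln 2)^-1 + (drift S mu * v + 0 * C).
  apply: cvgD; first by apply: cvgMr_tmp; exact: cvg_ln_div.
  apply: cvgD; first exact: cvgMr_tmp.
  by apply: cvgMr_tmp; exact: cvg_natV0.
rewrite !mul0r add0r addr0 in Bcvg.
rewrite -(cvg_lim _ Bcvg)//; apply: ler_lim => //; first by apply/cvg_ex; eexists; exact: Bcvg.
apply: nearW => n.
apply: le_trans (ler_wpM2l _ (Hle n)) _; first by rewrite invr_ge0.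
by rewrite /log2 !mulrDr !mulrA.
Qed.

Lemma entropy_le_drift_log_volume :
  entropy mu <= drift S mu * log_volume R S.
Proof.
have vcvg : (fun n => n%:R^-1 * log2 (sphere_card n)) @ \oo --> log_volume R S.
  apply: (fekete (u := fun n => log2 (sphere_card n))).
  - exact: log_sphere_ge0.
  - exact: log_sphere_subadd.
(* The bound holds for each [m > 0], hence eventually, and so passes to the limit in [m]. *)
apply: (cvgr_to_ge (cvgMl_tmp (a := drift S mu) vcvg)); near=> m; apply: entropy_le_drift_mul.
by near: m; exact: nbhs_infty_gt.
Unshelve. all: by end_near.
Qed.

End EntropyBound.

(** * From measures on the group to finite sums over the generators *)

Lemma finite_sym_gens (G : groupType) (k : nat) (x : 'I_k -> G) :
  finite_set (sym_gens x).
Proof. by rewrite /sym_gens finite_setU; split; exact: finite_image. Qed.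

Theorem theorem1 (R : realType) (G : groupType) (k : nat) (x : 'I_k -> G)
    (mu : G -> R) :
  ([set: G] #= [set: nat])%card ->
  generated_by x ->
  is_probability mu ->
  symmetric_measure mu ->
  concentrated_on mu (sym_gens x) ->
  entropy mu <= drift (sym_gens x) mu * log_volume R (sym_gens x).
Proof.
move=> _ x_gen [mu_ge0 mu_mass] _ mu_conc.
have S_fin := finite_sym_gens x.
have mu_out g : ~ sym_gens x g -> mu g = 0.
  move=> Sg; apply/eqP; rewrite eq_le mu_ge0 andbT -lee_fin.
  (* A point outside the generators weighs at most the mass of their complement, which is 0. *)
  rewrite -[leRHS]mu_conc; apply: esum_ge; exists [set g].
    by split; [exact: finite_set1|move=> h ->].
  by rewrite fsbig_set1.
apply: entropy_le_drift_log_volume => //.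
apply: EFin_inj; rewrite -mu_mass /mass.
(* Split the total mass 1 over the generators and their null complement; what remains is a finite
   sum. *)
rewrite (esumID (sym_gens x)) ?setTI; last by move=> g _; rewrite lee_fin.
rewrite [X in (_ + X)%E]mu_conc adde0 esum_fset//; last first.
  by move=> g _; rewrite lee_fin.
by rewrite -fsumEFin.
Qed.
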